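(* Let $D$ be an Arakelov divisor on $\overline{\operatorname{Spec}{\mathbb Z}}$. Then $$\dim_{\mathbb S} H^0(D)-\dim_{\mathbb S} H^1(D)=\lceil \deg_2 D\rceil'+1,$$ where $\deg_2 D:=\deg(D)/\log 2$ and $\lceil x\rceil'$ is the right continuous function of $x\in{\mathbb R}$ which agrees with $\operatorname{ceiling}(x)$ for non-integer $x>0$ and with $-\operatorname{ceiling}(-x)$ for non-integer $x<0$ (equivalently, $\lceil x\rceil'=\lfloor x\rfloor+1$ for $x\geq 0$ and $\lceil x\rceil'=\lfloor x\rfloor$ for $x<0$).
   Context: An Arakelov divisor on $\overline{\operatorname{Spec}{\mathbb Z}}$ is a formal sum $D=\sum_p a_p\{p\}+a_\infty\{\infty\}$ (finitely many nonzero $a_p\in{\mathbb Z}$, $a_\infty\in{\mathbb R}$), with $\deg D=\sum_p a_p\log p+a_\infty$. Put $\lambda=e^{\deg D}$. $H^0(D)$ is the ${\mathbb S}$-module $(H{\mathbb Z})_I$ with $I=[-\lambda,\lambda]\cap{\mathbb Z}$, where $(H{\mathbb Z})_X(k_+)=\{a\in{\mathbb Z}^k\mid\sum_{j\in Z}a_j\in X\ \forall Z\subset\{1,\dots,k\}\}$; $\dim_{\mathbb S}H^0(D)$ is the smallest cardinality of a subset $G\subset I$ such that for every $x\in I$ there is $Z\subset G$ with $\sum_{g\in Z}g=x$ and $\sum_{g\in Z'}g\in I$ for all $Z'\subset Z$ (so it is $0$ when $I=\{0\}$). $H^1(D)$ is the tolerant ${\mathbb S}$-module $(U(1),d)_\lambda$: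 the ${\mathbb S}$-module $H({\mathbb R}/{\mathbb Z})$ with, at level $1$, the tolerance relation $d(x,y)\leq\lambda$, where $d$ is the canonical metric of length $1$ on ${\mathbb R}/{\mathbb Z}$. $\dim_{\mathbb S}H^1(D)$ is the minimal cardinality of a subset $F\subset{\mathbb R}/{\mathbb Z}$ such that distinct elements of $F$ are at distance $>\lambda$ and every $x\in{\mathbb R}/{\mathbb Z}$ is at distance $\leq\lambda$ from $\sum_{g\in Z}g$ for some $Z\subset F$ (empty sum $=0$). *)

(* Defs.v *)
From HB Require Import structures.
From mathcomp Require Import all_boot all_order all_algebra ring_quotient.
From mathcomp Require Import finmap.
From mathcomp Require Import boolp classical_sets functions cardinality fsbigop.
From mathcomp Require Import reals topology normedtype sequences exp.

Set Implicit Arguments.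
Unset Strict Implicit.
Unset Printing Implicit Defensive.

Import Order.TTheory GRing.Theory Num.Theory.
Import numFieldNormedType.Exports.
Local Open Scope classical_set_scope.
Local Open Scope ring_scope.
Local Open Scope quotient_scope.
Local Open Scope card_scope.

(* A pointed map k_+ -> l_+, given by its restriction to {1, ..., k}; [None] is
   the base point of l_+. *)
Definition pmap (k l : nat) := 'I_k -> option 'I_l.

Definition pmap_id k : pmap k k := fun i => Some i.

Definition pmap_comp k l m (g : pmap l m) (f : pmap k l) : pmap k m :=
  fun i => obind g (f i).

(* The map k_+ -> 1_+ sending i to 1 and everything else to the base point. *)
Definition pmap_proj k (i : 'I_k) : pmap k 1 :=
  fun j => if j == i then Some ord0 else None.

Definition pmap_fold k : pmap k 1 := fun=> Some ord0.

(* S-modules (Gamma-sets): functors from finite pointed sets to pointed sets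
   that preserve the zero object. *)
Record smodule := SModule {
  level :> nat -> Type;
  base : forall k, level k;
  act : forall k l, pmap k l -> level k -> level l;
  level0 : forall x : level 0, x = base 0;
  act_base : forall k l (f : pmap k l), act f (base k) = base l;
  act_id : forall k (x : level k), act (@pmap_id k) x = x;
  act_comp : forall k l m (g : pmap l m) (f : pmap k l) (x : level k),
    act (pmap_comp g f) x = act g (act f x)
}.

Section EilenbergMacLane.
Variable A : zmodType.

Definition push k l (f : pmap k l) (a : {ffun 'I_k -> A}) : {ffun 'I_l -> A} :=
  [ffun j => \sum_(i | f i == Some j) a i].

Lemma push0 k l (f : pmap k l) : push f [ffun=> 0] = [ffun=> 0].
Proof. by apply/ffunP => j; rewrite !ffunE big1 // => i _; rewrite ffunE. Qed.

Lemma push_id k (a : {ffun 'I_k -> A}) : push (@pmap_id k) a = a.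
Proof.
apply/ffunP => j; rewrite ffunE; under eq_bigl do rewrite /pmap_id.
by rewrite (big_pred1 j) // => i; rewrite (inj_eq (@Some_inj _)).
Qed.

Lemma push_comp k l m (g : pmap l m) (f : pmap k l) (a : {ffun 'I_k -> A}) :
  push (pmap_comp g f) a = push g (push f a).
Proof.
apply/ffunP => h; rewrite !ffunE.
under [RHS]eq_bigr do rewrite ffunE.
rewrite (exchange_big_dep (fun i => pmap_comp g f i == Some h)) /=; last first.
  by move=> j i gj /eqP fi; rewrite /pmap_comp fi.
apply: eq_bigr => i; rewrite /pmap_comp; case fi: (f i) => [j0|//] /= gj0.
rewrite (big_pred1 j0) // => j /=; rewrite (inj_eq (@Some_inj _)) (eq_sym j0).
by case: (j =P j0) => [->|_]; rewrite ?gj0 ?andbF.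
Qed.

Lemma ffun0_uniq (a : {ffun 'I_0 -> A}) : a = [ffun=> 0].
Proof. by apply/ffunP => -[]. Qed.

Definition EM : smodule :=
  @SModule (fun k => {ffun 'I_k -> A}) (fun k => [ffun=> 0]) push
    ffun0_uniq push0 push_id push_comp.

Variables (X : {pred A}) (X0 : 0 \in X).

Definition subsums_in k (a : {ffun 'I_k -> A}) : bool :=
  [forall Z : {set 'I_k}, \sum_(j in Z) a j \in X].

Lemma subsums_in0 k : subsums_in ([ffun=> 0] : {ffun 'I_k -> A}).
Proof. by apply/forallP => Z; rewrite big1 // => j _; rewrite ffunE. Qed.

Lemma subsums_in_push k l (f : pmap k l) (a : {ffun 'I_k -> A}) :
  subsums_in a -> subsums_in (push f a).
Proof.
move/forallP => aX; apply/forallP => Z.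
rewrite (_ : \sum_(j in Z) _ =
   \sum_(i in [set i | if f i is Some j then j \in Z else false]%SET) a i) //.
under eq_bigr do rewrite ffunE.
rewrite (exchange_big_dep
  (mem [set i | if f i is Some j then j \in Z else false]%SET)) /=; last first.
  by move=> j i jZ /eqP fi; rewrite inE fi.
apply: eq_bigr => i; rewrite inE; case fi: (f i) => [j0|//] /= j0Z.
rewrite (big_pred1 j0) // => j /=; rewrite (inj_eq (@Some_inj _)) (eq_sym j0).
by case: (j =P j0) => [->|_]; rewrite ?j0Z ?andbF.
Qed.

Definition EMsub_level k := {a : {ffun 'I_k -> A} | subsums_in a}.

Definition EMsub_act k l (f : pmap k l) (a : EMsub_level k) : EMsub_level l :=
  exist _ (push f (val a)) (subsums_in_push f (valP a)).

Definition EMsub_base k : EMsub_level k := exist _ [ffun=> 0] (subsums_in0 k).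

Lemma EMsub_level0 (a : EMsub_level 0) : a = EMsub_base 0.
Proof. by apply: val_inj; exact: ffun0_uniq. Qed.

Lemma EMsub_act0 k l (f : pmap k l) :
  EMsub_act f (EMsub_base k) = EMsub_base l.
Proof. by apply: val_inj; exact: push0. Qed.

Lemma EMsub_act_id k (a : EMsub_level k) : EMsub_act (@pmap_id k) a = a.
Proof. by apply: val_inj; exact: push_id. Qed.

Lemma EMsub_act_comp k l m (g : pmap l m) (f : pmap k l) (a : EMsub_level k) :
  EMsub_act (pmap_comp g f) a = EMsub_act g (EMsub_act f a).
Proof. by apply: val_inj; exact: push_comp. Qed.

(* The sub-S-module (HA)_X of HA. *)
Definition EMsub : smodule :=
  @SModule EMsub_level EMsub_base EMsub_act
    EMsub_level0 EMsub_act0 EMsub_act_id EMsub_act_comp.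

End EilenbergMacLane.

(* Only the tolerance relation at level 1 enters the dimension. *)
Record tsmodule := TSModule {
  tsmod :> smodule;
  tol : tsmod 1 -> tsmod 1 -> Prop;
  tol_refl : forall x, tol x x;
  tol_sym : forall x y, tol x y -> tol y x
}.

Definition discrete (E : smodule) : tsmodule :=
  @TSModule E eq (@erefl _) (@esym _).

(* y is a sum of e_1, ..., e_k in E: some z in E(k_+) has components e_i and
   is mapped to y by the fold map k_+ -> 1_+. *)
Definition is_sum (E : smodule) k (e : 'I_k -> E 1) (y : E 1) : Prop :=
  exists z : E k, (forall i, act (pmap_proj i) z = e i) /\
                  act (@pmap_fold k) z = y.

(* A finite subset Z of F is given by an injective enumeration e of it. *)
Definition generates (E : tsmodule) (F : set (E 1)) : Prop :=
  (forall x y, F x -> F y -> x <> y -> ~ tol x y) /\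
  (forall x, exists k (e : 'I_k -> E 1) (y : E 1),
     [/\ injective e, forall i, F (e i), is_sum e y & tol x y]).

Definition least_card T (P : set T -> Prop) (n : nat) : Prop :=
  (exists F, P F /\ F #= `I_n) /\
  (forall m F, P F -> F #= `I_m -> (n <= m)%N).

Definition is_dimS (E : tsmodule) (n : nat) : Prop :=
  least_card (@generates E) n.

Section Circle.
Variable R : realType.

Definition integers : {pred R} := fun x => x \is a Num.int.

Lemma integers_zmod_closed : zmod_closed integers.
Proof. by split=> [|x y]; [exact: rpred0|exact: rpredB]. Qed.

HB.instance Definition _ :=
  GRing.isZmodClosed.Build R integers integers_zmod_closed.

Definition RmodZ : Type := @Quotient.quot R integers.

HB.instance Definition _ := GRing.Zmodule.on RmodZ.
HB.instance Definition _ := Quotient.on RmodZ.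

Definition circ_dist (x y : RmodZ) : R :=
  inf [set `|a - b| | a in [set a | \pi_(RmodZ) a = x]
                    & b in [set b | \pi_(RmodZ) b = y]].

Lemma circ_dist_sym x y : circ_dist x y = circ_dist y x.
Proof.
rewrite /circ_dist; congr inf; apply/seteqP; split=> r [a ax [b bY <-]];
  by exists b => //; exists a => //; rewrite distrC.
Qed.

Lemma circ_dist_xx x : circ_dist x x = 0.
Proof.
apply/eqP; rewrite eq_le; apply/andP; split.
  apply: ge_inf; first by exists 0 => _ [a _ [b _ <-]].
  by exists (repr x); [exact: reprK|exists (repr x); rewrite ?subrr ?normr0 //=;
    exact: reprK].
apply: lb_le_inf => [|_ [a _ [b _ <-]] //].
by exists `|repr x - repr x|, (repr x); [exact: reprK|exists (repr x) => //;
  exact: reprK].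
Qed.

Section Tolerance.
Variables (lambda : R) (lambda0 : 0 <= lambda).

Definition circ_tol (x y : EM RmodZ 1) : Prop :=
  circ_dist (x ord0) (y ord0) <= lambda.

Lemma circ_tol_refl x : circ_tol x x.
Proof. by rewrite /circ_tol circ_dist_xx. Qed.

Lemma circ_tol_sym x y : circ_tol x y -> circ_tol y x.
Proof. by rewrite /circ_tol circ_dist_sym. Qed.

(* (U(1), d)_lambda *)
Definition U1 : tsmodule :=
  @TSModule (EM RmodZ) circ_tol circ_tol_refl circ_tol_sym.

End Tolerance.
End Circle.

Record arakelov_divisor (R : realType) := ArakelovDivisor {
  fin_coef : {p : nat | prime p} -> int;
  fin_coef_finite : finite_set [set p | fin_coef p != 0];
  inf_coef : R
}.

Section Cohomology.
Variables (R : realType) (D : arakelov_divisor R).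

Definition deg : R :=
  (\sum_(p \in [set: {p : nat | prime p}])
      (fin_coef D p)%:~R * ln ((val p)%:R : R)) + inf_coef D.

Definition deg2 : R := deg / ln 2.

Definition lambda : R := expR deg.

Lemma lambda_ge0 : 0 <= lambda. Proof. exact: expR_ge0. Qed.

Definition int_itv : {pred int} := fun n => - lambda <= n%:~R <= lambda.

Lemma int_itv0 : 0 \in int_itv.
Proof. by rewrite unfold_in oppr_le0 lambda_ge0. Qed.

Definition H0 : tsmodule := discrete (EMsub int_itv0).

Definition H1 : tsmodule := U1 lambda_ge0.

End Cohomology.

Definition ceil' (R : realType) (x : R) : int :=
  if 0 <= x then Num.floor x + 1 else Num.floor x.
Section ExplicitSums.
Variable A : zmodType.

Lemma push_proj k (i : 'I_k) (a : {ffun 'I_k -> A}) :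
  push (pmap_proj i) a = [ffun=> a i].
Proof.
apply/ffunP => j; rewrite !ffunE (big_pred1 i) // => h.
by rewrite /pmap_proj (ord1 j) /=; case: (h == i).
Qed.

Lemma push_fold k (a : {ffun 'I_k -> A}) :
  push (@pmap_fold k) a = [ffun=> \sum_i a i].
Proof.
apply/ffunP => j; rewrite !ffunE; apply: eq_bigl => h.
by rewrite /pmap_fold (ord1 j) eqxx.
Qed.

Lemma sum_fset_enum k (e : 'I_k -> A) (Y : {fset A}) : injective e ->
  (forall y, y \in Y -> exists i, y = e i) ->
  \sum_(g <- Y) g = \sum_(i | e i \in Y) e i.
Proof.
move=> e_inj Ye; rewrite -[RHS]big_filter -(big_map e predT id).
apply: perm_big; apply: uniq_perm; first exact: fset_uniq.
  by rewrite map_inj_uniq // filter_uniq // index_enum_uniq.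
move=> y; apply/idP/mapP => [yY|[i]]; last by rewrite mem_filter => /andP[? _] ->.
by have [i yi] := Ye _ yY; exists i => //; rewrite mem_filter -yi yY mem_index_enum.
Qed.

Lemma enum_fsetP (X : {pred A}) (G : set A) (y : A) :
  (exists k (e : {ffun 'I_k -> A}),
     [/\ injective e, forall i, G (e i), \sum_i e i = y & subsums_in X e]) <->
  (exists Z : {fset A},
     [/\ [set` Z] `<=` G, \sum_(g <- Z) g = y
       & forall Z' : {fset A}, (Z' `<=` Z)%fset -> \sum_(g <- Z') g \in X]).
Proof.
split=> [[k [e [e_inj eG <- /forallP eX]]]|[Z [ZG <- ZX]]].
  pose Z := [fset e i | i in 'I_k]%fset.
  have ZE x : x \in Z -> exists i, x = e i by case/imfsetP => i _ ->; exists i.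
  exists Z; split=> [x /= /ZE[i ->] //||Z' /fsubsetP ZZ'].
    rewrite (sum_fset_enum e_inj ZE); apply: eq_bigl => i.
    by rewrite in_imfset.
  rewrite (@sum_fset_enum _ e) // => [|x /ZZ' /ZE //].
  have := eX [set i | e i \in Z']%SET.
  by under eq_bigl do rewrite inE.
pose e : {ffun 'I_#|` Z| -> A} := [ffun i : 'I_#|` Z| => nth 0 Z i].
have eE i : e i = nth 0 Z i by rewrite ffunE.
have e_inj : injective e.
  move=> i j; rewrite !eE => /eqP; rewrite nth_uniq ?fset_uniq //.
  by move/eqP/val_inj.
have eZ i : e i \in Z by rewrite eE mem_nth.
have ZE x : x \in Z -> exists i, x = e i.
  move=> xZ; have xs : (index x Z < #|` Z|)%N by rewrite index_mem.
  by exists (Ordinal xs); rewrite eE /= nth_index.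
exists #|` Z|, e; split=> // [i||]; first exact/ZG/eZ.
  by rewrite (sum_fset_enum e_inj ZE); apply: eq_bigl => i; rewrite eZ.
apply/forallP => T.
pose Y := [fset e i | i in T]%fset.
have YZ : (Y `<=` Z)%fset by apply/fsubsetP => x /imfsetP[i _ ->].
have := ZX _ YZ; rewrite (sum_fset_enum e_inj); last first.
  by move=> x /imfsetP[i _ ->]; exists i.
under eq_bigl => i.
  by rewrite (_ : (e i \in Y) = (i \in T)); first over; rewrite mem_imfset.
by [].
Qed.

End ExplicitSums.

Lemma least_card_iso (T U : Type) (P : set T -> Prop) (Q : set U -> Prop)
    (phi : T -> U) n : injective phi ->
  (forall F, P F -> Q (phi @` F)) ->
  (forall G, Q G -> G `<=` range phi /\ P (phi @^-1` G)) ->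
  least_card P n <-> least_card Q n.
Proof.
move=> phi_inj PQ QP.
have cardF (F : set T) m : F #= `I_m -> phi @` F #= `I_m.
  by move=> Fm; apply: card_eq_trans Fm; apply: inj_card_eq; exact: in2W.
have cardG (G : set U) m : Q G -> G #= `I_m -> phi @^-1` G #= `I_m.
  move=> /QP[Gr _] Gm; have GE : phi @` (phi @^-1` G) = G.
    apply/seteqP; split=> [_ [t Gt <-] //|u Gu].
    by have [t _ tu] := Gr _ Gu; exists t => //=; rewrite tu.
  apply: (card_eq_trans _ Gm); rewrite card_eq_sym -[X in X #= _]GE.
  by apply: inj_card_eq; exact: in2W.
split=> -[[F [PF Fn]] min]; split.
- by exists (phi @` F); split; [exact: PQ|exact: cardF].
- by move=> m G QG Gm; apply: (min m (phi @^-1` G)); [case: (QP _ QG)|exact: cardG].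
- by exists (phi @^-1` F); split; [case: (QP _ PF)|exact: cardG].
- by move=> m G PG Gm; apply: (min m (phi @` G)); [exact: PQ|exact: cardF].
Qed.

Lemma is_dimS_EMsubP (A : zmodType) (X : {pred A}) (X0 : 0 \in X) n :
  is_dimS (discrete (EMsub X0)) n <->
  least_card (fun G : set A => G `<=` [set` X] /\
    forall x, x \in X -> exists Z : {fset A},
      [/\ [set` Z] `<=` G, \sum_(g <- Z) g = x
        & forall Z' : {fset A}, (Z' `<=` Z)%fset -> \sum_(g <- Z') g \in X]) n.
Proof.
have single x : x \in X -> subsums_in X ([ffun=> x] : {ffun 'I_1 -> A}).
  move=> xX; apply/forallP => Z; case: (boolP (ord0 \in Z)) => oZ.
    rewrite (big_pred1 ord0) ?ffunE // => i.
    by rewrite (ord1 i) oZ.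
  by rewrite big_pred0 // => i; rewrite (ord1 i); exact: negbTE.
pose mk x (xX : x \in X) : EMsub X0 1 := exist _ [ffun=> x] (single x xX).
pose phi (a : EMsub X0 1) : A := val a ord0.
have phi_inj : injective phi.
  by move=> a b ab; apply: val_inj; apply/ffunP => i; rewrite (ord1 i).
have phiX a : phi a \in X.
  have /forallP/(_ [set ord0]%SET) := valP a.
  by rewrite big_set1.
have phi_sum k (e : 'I_k -> EMsub X0 1) y : is_sum e y <->
    \sum_i phi (e i) = phi y /\ subsums_in X [ffun i => phi (e i)].
  split=> [[z [ze zy]]|[ey eX]].
    have zE i : phi (e i) = val z i by rewrite -ze /phi /= push_proj ffunE.
    split; first by rewrite -zy /phi /= push_fold ffunE; apply: eq_bigr => i _; exact: zE.
    by rewrite (_ : finfun _ = val z) ?(valP z) //; apply/ffunP => i; rewrite ffunE zE.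
  exists (exist _ [ffun i => phi (e i)] eX); split=> [i|]; apply: phi_inj.
    by rewrite /phi /= push_proj !ffunE.
  by rewrite /phi /= push_fold ffunE -[RHS]ey; apply: eq_bigr => i _; rewrite ffunE.
apply: (@least_card_iso _ _ _ _ phi) => // [F [_ Fgen]|G [GX Ggen]].
  split=> [_ [a _ <-] /=|x xX]; first exact: phiX.
  have [k [e [y [e_inj eF /phi_sum[ey eX] xy]]]] := Fgen (mk x xX).
  apply/enum_fsetP; exists k, [ffun i => phi (e i)]; split=> //.
  - by move=> i j; rewrite !ffunE => /phi_inj/e_inj.
  - by move=> i; rewrite ffunE; exists (e i).
  - by under eq_bigr do rewrite ffunE; rewrite ey -xy /phi /= ffunE.
split=> [g /GX gX|].
  by exists (mk g gX) => //; rewrite /phi /= ffunE.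
split=> // x; have /enum_fsetP[k [e [e_inj eG ex eX]]] := Ggen _ (phiX x).
have eiX i : e i \in X by exact/GX/eG.
have phie i : phi (mk _ (eiX i)) = e i by rewrite /phi /= ffunE.
exists k, (fun i => mk _ (eiX i)), x; split=> //.
- by move=> i j /(congr1 phi); rewrite !phie => /e_inj.
- by move=> i; rewrite /= phie; exact: eG.
- apply/phi_sum; split; first by under eq_bigr do rewrite phie.
  by rewrite (_ : finfun _ = e) //; apply/ffunP => i; rewrite ffunE phie.
Qed.

Lemma is_dimS_U1P (R : realType) (l : R) (l0 : 0 <= l) n :
  is_dimS (U1 l0) n <->
  least_card (fun F : set (RmodZ R) =>
    (forall x y, F x -> F y -> x <> y -> l < circ_dist x y) /\
    forall x, exists Z : {fset RmodZ R},
      [set` Z] `<=` F /\ circ_dist x (\sum_(g <- Z) g) <= l) n.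
Proof.
pose mk (x : RmodZ R) : U1 l0 1 := [ffun=> x].
pose phi (a : U1 l0 1) : RmodZ R := a ord0.
have phiK : cancel phi mk.
  by move=> a; apply/ffunP => i; rewrite ffunE (ord1 i).
have mkK : cancel mk phi by move=> x; rewrite /phi ffunE.
have phi_inj := can_inj phiK.
have phi_sum k (e : 'I_k -> U1 l0 1) y : is_sum (E := U1 l0) e y <->
    \sum_i phi (e i) = phi y.
  split=> [[z [ze zy]]|ey].
    rewrite -zy /phi /= push_fold ffunE; apply: eq_bigr => i _.
    by rewrite -ze /= push_proj ffunE.
  exists ([ffun i => phi (e i)] : {ffun 'I_k -> RmodZ R}); split=> [i|];
    apply: phi_inj.
    by rewrite /phi /= push_proj !ffunE.
  by rewrite /phi /= push_fold ffunE -[RHS]ey; apply: eq_bigr => i _; rewrite ffunE.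
have allT k (e : {ffun 'I_k -> RmodZ R}) : subsums_in predT e by exact/forallP.
apply: (@least_card_iso _ _ _ _ phi) => // [F [Fsep Fgen]|G [Gsep Ggen]].
  split=> [_ _ [a Fa <-] [b Fb <-] ab|x].
    have {}ab : a <> b by move=> E; apply: ab; rewrite E.
    by have /negP := Fsep _ _ Fa Fb ab; rewrite -ltNge.
  have [k [e [y [e_inj eF /phi_sum ey xy]]]] := Fgen (mk x).
  have /enum_fsetP[Z [ZF Zy _]] : exists k (e : {ffun 'I_k -> RmodZ R}),
      [/\ injective e, forall i, (phi @` F) (e i), \sum_i e i = phi y
        & subsums_in predT e].
    exists k, [ffun i => phi (e i)]; split=> //.
    - by move=> i j; rewrite !ffunE => /phi_inj/e_inj.
    - by move=> i; rewrite ffunE; exists (e i).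
    - by under eq_bigr do rewrite ffunE.
  by exists Z; split=> //; rewrite Zy; move: xy; rewrite /= /circ_tol ffunE.
split=> [g _|]; first by exists (mk g).
split=> [x y Gx Gy xy|x].
  have {}xy : phi x <> phi y by move=> /phi_inj.
  by apply/negP; rewrite -ltNge; exact: Gsep.
have [Z [ZG Zx]] := Ggen (phi x).
have /enum_fsetP[k [e [e_inj eG ex _]]] : exists Z' : {fset RmodZ R},
    [/\ [set` Z'] `<=` G, \sum_(g <- Z') g = \sum_(g <- Z) g
      & forall Z'' : {fset RmodZ R}, (Z'' `<=` Z')%fset ->
          \sum_(g <- Z'') g \in predT] by exists Z.
exists k, (fun i => mk (e i)), (mk (\sum_(g <- Z) g)); split=> //.
- by move=> i j /(congr1 phi); rewrite !mkK => /e_inj.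
- by move=> i; rewrite /= mkK; exact: eG.
- by apply/phi_sum; rewrite mkK -ex; apply: eq_bigr => i _; rewrite mkK.
- by rewrite /= /circ_tol -/(phi _) -/(phi (mk _)) mkK.
Qed.

Section CeilPrime.
Variable R : realType.
Implicit Type x : R.

Lemma ceil'_pos x : x \isn't a Num.int -> 0 < x -> ceil' x = Num.ceil x.
Proof.
by move=> xZ x0; rewrite /ceil' (ltW x0) ceil_floor xZ.
Qed.

Lemma ceil'_neg x : x \isn't a Num.int -> x < 0 -> ceil' x = - Num.ceil (- x).
Proof. by move=> xZ x0; rewrite /ceil' leNgt x0 /= floorNceil. Qed.

Lemma ceil'_right_continuous x :
  ((ceil' y)%:~R : R) @[y --> x^'+] --> ((ceil' x)%:~R : R).
Proof.
apply: cvg_near_cst; near=> y.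
have xy : x < y by near: y; exact: nbhs_right_gt.
have yf : y < (Num.floor x + 1)%:~R.
  by near: y; apply: nbhs_right_lt; exact: floorD1_gt.
have fE : Num.floor y = Num.floor x.
  apply: floor_def; rewrite yf andbT.
  exact: le_trans (floor_le _) (ltW xy).
rewrite /ceil' fE; congr (_%:~R); case: ifPn => y0; case: ifPn => x0 //.
  have : 0 <= Num.floor x by rewrite -fE floor_ge0.
  by rewrite floor_ge0 (negbTE x0).
by rewrite (le_trans x0 (ltW xy)) in y0.
Unshelve. all: by end_near. Qed.

End CeilPrime.

(* Main.v *)
(* Write lambda = e^(deg D) = 2^(deg_2 D).  A set of n generators has at most
   2^n subset sums, so n generators of [-N, N] force 2^n >= 2 N + 1; on the
   circle, the arcs of radius lambda around the subset sums have to cover total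
   length 1, hence 2^(n+1) lambda >= 1.  Both bounds are attained by doubling an
   element x repeatedly, since the subset sums of x, 2x, ..., 2^(k-1) x are the
   c x with c < 2^k: for 2^k <= N < 2^(k+1) take 1, 2, ..., 2^k together with
   -N, a negative x being -N + (N + x); for 2^-(p+1) <= lambda < 2^-p take
   the first p doublings of the class of 2^-p.  According to the sign of
   deg_2 D, one of the two dimensions vanishes. *)
Require Import Defs.
From mathcomp Require Import all_boot all_order all_algebra ring_quotient.
From mathcomp Require Import finmap boolp classical_sets cardinality.
From mathcomp Require Import reals exp zify lra ring.

Set Implicit Arguments.
Unset Strict Implicit.
Unset Printing Implicit Defensive.

Import Order.TTheory GRing.Theory Num.Theory.
Local Open Scope classical_set_scope.
Local Open Scope ring_scope.
Local Open Scope quotient_scope.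

Lemma least_card_fset (T : choiceType) (P : set T -> Prop) (G : {fset T}) :
    P [set` G] -> (forall H : {fset T}, P [set` H] -> (#|` G| <= #|` H|)%N) ->
  least_card P #|` G|.
Proof.
move=> PG Gmin; split=> [|m F PF Fm].
  by exists [set` G]; split=> //; exact/card_eq_fsetP.
have FE : [set` fset_set F] = F by apply: fset_setK; exists m.
by rewrite -(card_fset_set Fm); apply: Gmin; rewrite FE.
Qed.

Lemma size_int_itv (R : archiRealDomainType) (u v : R) (s : seq int) :
    u <= v -> uniq s -> {in s, forall n, u <= n%:~R <= v} ->
  (size s)%:R <= v - u + 1.
Proof.
move=> uv s_uniq s_itv; set a := Num.ceil u; set b := Num.floor v.
have /andP[a1u ua] := ceil_itv u; have /andP[bv _] := floor_itv v.
have ab : a - 1 <= b by rewrite floor_ge_int; exact: ltW (lt_le_trans a1u uv).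
suff le_size : (size s <= `|(b - a + 1)%R|)%N.
  apply: (@le_trans _ _ (b - a + 1)%:~R); last first.
    by rewrite !(rmorphD, rmorphN) /= lerD2r lerB.
  by rewrite -[(size s)%:R]/((size s)%:Z%:~R) ler_int; lia.
rewrite -(size_iota 0 `|(b - a + 1)%R|) -(size_map (fun n => `|(n - a)%R|%N)).
have s_ab n : n \in s -> a <= n <= b.
  by move=> /s_itv/andP[un nv]; rewrite ceil_le_int un floor_ge_int.
apply: uniq_leq_size => [|_ /mapP[n /s_ab/andP[an nb] ->]].
  rewrite map_inj_in_uniq // => m n /s_ab/andP[am _] /s_ab/andP[an _]; lia.
by rewrite mem_iota; lia.
Qed.

Section SubsetSums.
Variable A : zmodType.
Implicit Types (x : A) (G : {fset A}).

Definition subset_sums G : {fset A} :=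
  [fset \sum_(g <- Z) g | Z : {fset A} in fpowerset G]%fset.

Lemma subset_sumsP G x :
  reflect (exists2 Z : {fset A}, (Z `<=` G)%fset & \sum_(g <- Z) g = x)
          (x \in subset_sums G).
Proof.
apply: (iffP (imfsetP _ _ _ _)) => -[Z /=].
  by rewrite fpowersetE => ZG ->; exists Z.
by move=> ZG <-; exists Z; rewrite //= fpowersetE.
Qed.

Lemma card_subset_sums G : (#|` subset_sums G| <= 2 ^ #|` G|)%N.
Proof. by rewrite -card_fpowerset; exact: leq_imfset_card. Qed.

Definition doublings x k : {fset A} := [fset x *+ 2 ^ i | i in iota 0 k]%fset.

Lemma doublingsP x k y :
  reflect (exists2 i, (i < k)%N & y = x *+ 2 ^ i) (y \in doublings x k).
Proof.
by apply: (iffP (imfsetP _ _ _ _)) => -[i /= ik ->]; exists i;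
  rewrite ?mem_iota in ik *.
Qed.

Lemma doublingsS x k : doublings x k.+1 = (x *+ 2 ^ k |` doublings x k)%fset.
Proof.
apply/fsetP => y; rewrite in_fset1U; apply/doublingsP/predU1P.
  case=> i; rewrite ltnS leq_eqVlt => /predU1P[-> ->|ik ->]; first by left.
  by right; apply/doublingsP; exists i.
case=> [->|/doublingsP[i ik ->]]; first by exists k.
by exists i; rewrite // ltnS ltnW.
Qed.

Lemma leq_card_doublings x k : (#|` doublings x k| <= k)%N.
Proof.
apply: leq_trans (leq_imfset_card _ _ _) _.
by rewrite /= undup_id ?iota_uniq ?size_iota.
Qed.

Lemma card_doublings x k : {in gtn (2 ^ k)%N &, injective (GRing.natmul x)} ->
  #|` doublings x k| = k.
Proof.
move=> x_inj; rewrite card_in_imfset /= ?undup_id ?size_iota ?iota_uniq //.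
move=> i j; rewrite !mem_iota /= => ik jk /x_inj.
by rewrite !inE !ltn_exp2l // => /(_ ik jk)/eqP; rewrite eqn_exp2l // => /eqP.
Qed.

Lemma mulrn_subset_sums x k c : #|` doublings x k| = k -> (c < 2 ^ k)%N ->
  x *+ c \in subset_sums (doublings x k).
Proof.
elim: k c => [|k IH] c.
  rewrite expn0 ltnS leqn0 => _ /eqP ->; apply/subset_sumsP.
  by exists fset0; rewrite ?fsub0set // big_seq_fset0.
rewrite doublingsS cardfsU1; case: (boolP (x *+ 2 ^ k \in _)) => [_ cardE|xk].
  by have := leq_card_doublings x k; rewrite -ltnS -cardE add0n ltnn.
rewrite add1n => -[cardE] ck; have [c_lt|c_ge] := ltnP c (2 ^ k).
  have /subset_sumsP[Z Zx <-] := IH _ cardE c_lt.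
  by apply/subset_sumsP; exists Z => //; exact: fsubset_trans (fsubsetU1 _ _).
have /(IH _ cardE)/subset_sumsP[Z Zx ZE] : (c - 2 ^ k < 2 ^ k)%N.
  by move: ck; rewrite expnS; lia.
apply/subset_sumsP; exists (x *+ 2 ^ k |` Z)%fset; first exact: fsetUS.
rewrite big_fsetU1 /= ?ZE -?mulrnDr ?subnKC //.
by apply: contra xk; exact: (fsubsetP Zx).
Qed.

End SubsetSums.

Lemma sumr_fsubset_itv (R : numDomainType) (a : R) (P Z : {fset R}) :
    a <= 0 -> {in P, forall g, 0 <= g} -> (Z `<=` a |` P)%fset ->
  a <= \sum_(g <- Z) g <= \sum_(g <- P) g.
Proof.
move=> a0 P0.
have sum_itv (Y : {fset R}) : (Y `<=` P)%fset ->
    0 <= \sum_(g <- Y) g <= \sum_(g <- P) g.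
  move=> YP; rewrite (big_fsetID _ (mem Y) P) /=.
  have -> : [fset g in P | g \in Y]%fset = Y.
    by apply/fsetP => g; rewrite !inE /= andb_idl // => /(fsubsetP YP).
  rewrite lerDl !big_seq !sumr_ge0 // => g; first by rewrite !inE => /andP[/P0].
  by move/(fsubsetP YP)/P0.
move=> ZaP; have ZP : (Z `\ a `<=` P)%fset by rewrite fsubDset.
have [aZ|aZ] := boolP (a \in Z).
  have /andP[Z0 ZsP] := sum_itv _ ZP; rewrite (big_fsetD1 a) //= lerDl Z0 /=.
  by apply: le_trans ZsP; rewrite gerDr.
rewrite mem_fsetD1 // in ZP; have /andP[Z0 ->] := sum_itv _ ZP.
by rewrite (le_trans a0).
Qed.

Section EilenbergMacLaneDimension.
Variables (A : zmodType) (X : {pred A}).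

Definition EMsub_generating (G : set A) : Prop :=
  G `<=` [set` X] /\
  forall x, x \in X -> exists Z : {fset A},
    [/\ [set` Z] `<=` G, \sum_(g <- Z) g = x
      & forall Z' : {fset A}, (Z' `<=` Z)%fset -> \sum_(g <- Z') g \in X].

Lemma is_dimS_EMsub (X0 : 0 \in X) (G : {fset A}) :
    EMsub_generating [set` G] ->
    (forall H : {fset A}, EMsub_generating [set` H] -> (#|` G| <= #|` H|)%N) ->
  is_dimS (discrete (EMsub X0)) #|` G|.
Proof. by move=> XG Gmin; apply/is_dimS_EMsubP; exact: least_card_fset. Qed.

Lemma EMsub_generating_size (G : {fset A}) (s : seq A) :
    EMsub_generating [set` G] -> uniq s -> {subset s <= X} ->
  (size s <= 2 ^ #|` G|)%N.
Proof.
move=> [_ Ggen] s_uniq sX; apply: leq_trans (card_subset_sums G).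
apply: uniq_leq_size => // x /sX/Ggen[Z [ZG Zx _]].
by apply/subset_sumsP; exists Z => //; exact/fsubsetP.
Qed.

Lemma is_dimS_EMsub_singleton (X0 : 0 \in X) : (forall x, x \in X -> x = 0) ->
  is_dimS (discrete (EMsub X0)) 0.
Proof.
move=> XE; rewrite -[0%N](cardfs0 A).
apply: is_dimS_EMsub => [|H _]; last first.
  by rewrite cardfs0.
split=> [x|x /XE ->]; first by rewrite /= inE.
exists fset0; split=> [//||Z']; first by rewrite big_seq_fset0.
by rewrite fsubset0 => /eqP ->; rewrite big_seq_fset0.
Qed.

End EilenbergMacLaneDimension.

Section IntegerIntervalDimension.
Variables (X : {pred int}) (N k : nat).
Hypothesis XE : forall x, (x \in X) = (- N%:Z <= x <= N%:Z).
Hypothesis N_itv : (2 ^ k <= N < 2 ^ k.+1)%N.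

Definition int_itv_generators : {fset int} := (- N%:Z |` doublings 1 k.+1)%fset.

Lemma card_doublings_int1 n : #|` doublings (1 : int) n| = n.
Proof. by apply: card_doublings => i j _ _; rewrite !natz => -[]. Qed.

Lemma doublings_int1_itv g : g \in doublings (1 : int) k.+1 -> 0 <= g <= N%:Z.
Proof.
case/doublingsP => i; rewrite ltnS => ik ->.
by rewrite natz lez_nat (leq_trans _ (andP N_itv).1) // leq_exp2l.
Qed.

Lemma oppN_notin_doublings : - N%:Z \notin doublings 1 k.+1.
Proof.
apply/negP => /doublings_int1_itv/andP[+ _].
by have := expn_gt0 2 k; have /andP[] := N_itv; lia.
Qed.

Lemma card_int_itv_generators : #|` int_itv_generators| = k.+2.
Proof. by rewrite cardfsU1 oppN_notin_doublings card_doublings_int1. Qed.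

Lemma subset_sum_int_itv n (P Z : {fset int}) :
    (P `<=` doublings 1 k.+1)%fset -> \sum_(g <- P) g = n%:Z -> (n <= N)%N ->
    (Z `<=` - N%:Z |` P)%fset ->
  \sum_(g <- Z) g \in X.
Proof.
move=> /fsubsetP P2 Pn nN ZP.
have [||Z1 Z2] := andP (@sumr_fsubset_itv _ (- N%:Z) P Z _ _ ZP); first by lia.
  by move=> g /P2/doublings_int1_itv/andP[].
by rewrite XE Z1 (le_trans Z2) // Pn.
Qed.

Lemma EMsub_generating_int_itv : EMsub_generating X [set` int_itv_generators].
Proof.
have nat_sum n : (n <= N)%N ->
    exists2 P, (P `<=` doublings 1 k.+1)%fset & \sum_(g <- P) g = n%:Z.
  move=> nN; apply/subset_sumsP; rewrite -[n%:Z]natz.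
  apply: mulrn_subset_sums; first exact: card_doublings_int1.
  by case/andP: N_itv => _; exact: leq_ltn_trans.
split=> [g /=|x].
  rewrite in_fset1U XE => /predU1P[->|/doublings_int1_itv]; lia.
rewrite XE => /andP[Nx xN]; have [x0|x0] := leP 0 x.
  have [|P P2 Px] := nat_sum `|x|%N; first by lia.
  exists P; split=> [g /= /(fsubsetP P2) g2||Z ZP].
  - by rewrite in_fset1U g2 orbT.
  - by rewrite Px; lia.
  - apply: subset_sum_int_itv P2 Px _ _; first by lia.
    exact: fsubset_trans ZP (fsubsetU1 _ _).
have [|P P2 Px] := nat_sum `|(N%:Z + x)%R|%N; first by lia.
have NP : - N%:Z \notin P.
  by apply: contra oppN_notin_doublings; exact: fsubsetP.
exists (- N%:Z |` P)%fset; split=> [g /=||Z ZP].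
- by rewrite !in_fset1U => /predU1P[->|/(fsubsetP P2) ->]; rewrite ?eqxx ?orbT.
- by rewrite (big_fsetU1 _ _ NP) /= Px; lia.
- by apply: subset_sum_int_itv P2 Px _ ZP; lia.
Qed.

Lemma is_dimS_EMsub_int_itv (X0 : 0 \in X) : is_dimS (discrete (EMsub X0)) k.+2.
Proof.
rewrite -card_int_itv_generators; apply: is_dimS_EMsub => [|H XH].
  exact: EMsub_generating_int_itv.
pose s := [seq i%:Z - N%:Z | i <- iota 0 N.*2.+1].
have s_uniq : uniq s by rewrite map_inj_uniq ?iota_uniq // => i j; lia.
have sX : {subset s <= X} by move=> _ /mapP[i + ->]; rewrite mem_iota XE; lia.
have := EMsub_generating_size XH s_uniq sX; rewrite size_map size_iota => leH.
rewrite card_int_itv_generators -(@ltn_exp2l 2) //; apply: leq_trans leH.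
by case/andP: N_itv => kN _; rewrite expnS; lia.
Qed.

End IntegerIntervalDimension.

Section CircleDistance.
Variable R : realType.
Implicit Types (a b l : R) (m : int).

Lemma pi_RmodZ_eqP a b :
  (\pi_(RmodZ R) a = \pi_(RmodZ R) b) <-> a - b \is a Num.int.
Proof.
have -> : (a - b \is a Num.int) = (\pi_(RmodZ R) a == \pi_(RmodZ R) b).
  exact: (Quotient.idealrBE (@integers R) a b).
by split=> /eqP.
Qed.

Lemma circ_dist_le a b m :
  circ_dist (\pi_(RmodZ R) a) (\pi_(RmodZ R) b) <= `|a - b + m%:~R|.
Proof.
apply: ge_inf; first by exists 0 => _ [? _ [? _ <-]].
exists (a + m%:~R); last by exists b => //; rewrite addrAC.
by apply/pi_RmodZ_eqP; rewrite addrAC subrr add0r intr_int.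
Qed.

Lemma circ_dist_ge l a b : (forall m, l <= `|a - b + m%:~R|) ->
  l <= circ_dist (\pi_(RmodZ R) a) (\pi_(RmodZ R) b).
Proof.
move=> lab; apply: lb_le_inf; first by exists `|a - b|, a => //; exists b.
move=> _ [c /= /pi_RmodZ_eqP/intrP[m mE] [d /= /pi_RmodZ_eqP/intrP[n nE] <-]].
have -> : c - d = a - b + (m - n)%:~R by rewrite rmorphB /= -mE -nE; ring.
exact: lab.
Qed.

Lemma circ_dist_attained a b :
  exists m, circ_dist (\pi_(RmodZ R) a) (\pi_(RmodZ R) b) = `|a - b + m%:~R|.
Proof.
pose f := Num.floor (a - b + 2^-1); exists (- f).
apply: le_anti; rewrite circ_dist_le; apply: circ_dist_ge => m.
have [->|mf] := eqVneq m (- f) => //.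
have near : `|a - b + (- f)%:~R| <= 2^-1.
  have /andP[] := floor_itv (a - b + 2^-1).
  by rewrite -/f !rmorphD rmorphN ler_norml => f1 f2; apply/andP; split; lra.
have far : 1 <= `|a - b + m%:~R| + `|a - b + (- f)%:~R|.
  apply: le_trans (ler_normB _ _).
  rewrite opprD addrACA subrr add0r -rmorphB /=.
  by rewrite norm_intr_ge1 ?intr_int // intr_eq0 subr_eq0.
lra.
Qed.

End CircleDistance.

Section CircleTorsion.
Variable R : realType.
Implicit Types (x : RmodZ R) (K : nat).

Definition torsion_gen K : RmodZ R := \pi_(RmodZ R) K%:R^-1.

Lemma torsion_genMn K c : torsion_gen K *+ c = \pi_(RmodZ R) (c%:R / K%:R).
Proof.
by rewrite mulr_natl (raddfMn (\pi_(@Quotient.quot R (@integers R)))).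
Qed.

Lemma circ_dist_torsion_ge K c d : (0 < K)%N -> (c != d %[mod K])%N ->
  K%:R^-1 <= circ_dist (torsion_gen K *+ c) (torsion_gen K *+ d).
Proof.
move=> K0 cd; rewrite !torsion_genMn; apply: circ_dist_ge => m.
have KR0 : 0 < K%:R :> R by rewrite ltr0n.
have -> : c%:R / K%:R - d%:R / K%:R + m%:~R
    = (c%:Z - d%:Z + m * K%:Z)%:~R / K%:R :> R.
  by rewrite !(rmorphD, rmorphN, rmorphM) /=; field; rewrite gt_eqF.
rewrite normrM normfV (gtr0_norm KR0) ler_peMl ?invr_ge0 ?ler0n //.
rewrite norm_intr_ge1 ?intr_int // intr_eq0.
apply: contra cd => /eqP cdm; rewrite -eqz_nat -!modz_nat.
have -> : d%:Z = m * K%:Z + c%:Z by lia.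
by rewrite modzMDl.
Qed.

Lemma torsion_gen_inj K :
  {in gtn K &, injective (GRing.natmul (torsion_gen K))}.
Proof.
move=> c d; rewrite !inE => cK dK gcd; apply/eqP/negPn/negP => c_neq_d.
have K0 : (0 < K)%N by case: (K) cK.
have : K%:R^-1 <= circ_dist (torsion_gen K *+ c) (torsion_gen K *+ d).
  by apply: circ_dist_torsion_ge; rewrite ?modn_small.
by rewrite [torsion_gen K *+ c]gcd circ_dist_xx invr_le0 leNgt ltr0n K0.
Qed.

Lemma torsion_dense K x : (0 < K)%N ->
  exists2 c, (c < K)%N & circ_dist x (torsion_gen K *+ c) <= (2 * K%:R)^-1.
Proof.
move=> K0; pose f := Num.floor (repr x * K%:R + 2^-1).
have KZ0 : K%:Z != 0 by rewrite eqz_nat -lt0n.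
have KR0 : 0 < K%:R :> R by rewrite ltr0n.
have [c cE] : exists c : nat, c%:Z = (f %% K%:Z)%Z.
  by exists `|(f %% K%:Z)%Z|%N; rewrite gez0_abs ?modz_ge0.
exists c; first by rewrite -ltz_nat cE ltz_mod.
rewrite torsion_genMn -[x]reprK.
apply: le_trans (circ_dist_le _ _ (- (f %/ K%:Z)%Z)) _.
have fE : f%:~R = (f %/ K%:Z)%Z%:~R * K%:R + c%:R :> R.
  by rewrite {1}(divz_eq f K%:Z) rmorphD rmorphM -cE.
have -> : repr x - c%:R / K%:R + (- (f %/ K%:Z)%Z)%:~R
    = (repr x * K%:R - f%:~R) / K%:R.
  by rewrite fE rmorphN /=; field; rewrite gt_eqF.
rewrite normrM normfV (gtr0_norm KR0) invfM ler_pM2r ?invr_gt0 // ler_norml.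
have /andP[] := floor_itv (repr x * K%:R + 2^-1).
rewrite -/f rmorphD /= => f1 f2; apply/andP; split; lra.
Qed.

Lemma count_torsion_arc K x l : (0 < K)%N -> 0 <= l ->
  (count (fun c => circ_dist x (torsion_gen K *+ c) <= l) (iota 0 K))%:R
    <= 2 * l * K%:R + 1.
Proof.
move=> K0 l0; rewrite -size_filter; set s := filter _ _.
have KR0 : 0 < K%:R :> R by rewrite ltr0n.
have [m mP] := choice (fun c => circ_dist_attained (repr x) (c%:R / K%:R)).
pose unwrap c : int := c%:Z - m c * K%:Z.
have s_lt c : c \in s -> (c < K)%N.
  by rewrite mem_filter mem_iota => /andP[].
have unwrap_inj : {in s &, injective unwrap}.
  move=> c d /s_lt cK /s_lt dK /(congr1 (modz^~ K%:Z)).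
  rewrite /unwrap -!mulNr ![_ + - _ * _]addrC !modzMDl !modz_nat.
  by rewrite !modn_small // => -[].
have unwrap_itv : {in map unwrap s, forall n : int,
    (repr x - l) * K%:R <= n%:~R <= (repr x + l) * K%:R}.
  move=> _ /mapP[c + ->]; rewrite mem_filter torsion_genMn => /andP[+ _].
  rewrite -[x in circ_dist x]reprK mP ler_norml => /andP[l1 l2].
  have -> : (unwrap c)%:~R = (c%:R / K%:R - (m c)%:~R) * K%:R :> R.
    by rewrite /unwrap rmorphB rmorphM /=; field; rewrite gt_eqF.
  by rewrite !ler_pM2r //; apply/andP; split; lra.
rewrite -(size_map unwrap).
rewrite (le_trans (size_int_itv _ _ unwrap_itv)) //; last 2 first.
- by rewrite map_inj_in_uniq // filter_uniq // iota_uniq.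
- lra.
by rewrite ler_pM2r //; lra.
Qed.

(* A union of size S arcs of length 2 l contains at most (2 l K + 1) (size S) of
   the K points of order dividing K; let K tend to infinity. *)
Lemma arcs_cover_ge1 l (S : seq (RmodZ R)) : 0 <= l ->
    (forall x, exists2 s, s \in S & circ_dist x s <= l) ->
  1 <= 2 * l * (size S)%:R.
Proof.
move=> l0 cover.
have le_size K : (0 < K)%N -> K%:R <= (2 * l * K%:R + 1) * (size S)%:R.
  move=> K0; rewrite -{1}(size_iota 0 K).
  apply: (@le_trans _ _ (\sum_(c <- iota 0 K) \sum_(s <- S)
      (circ_dist s (torsion_gen K *+ c) <= l)%R)%:R).
    rewrite ler_nat -sum1_size leq_sum // => c _.
    have [s sS sl] := cover (torsion_gen K *+ c).
    by rewrite (big_rem s) //= circ_dist_sym sl.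
  rewrite exchange_big natr_sum mulr_natr -sum1_size -sumrMnr.
  apply: ler_sum => s _; rewrite mulr1n -big_mkcond sum1_count.
  exact: count_torsion_arc.
rewrite leNgt; apply/negP => lS.
set d := 1 - 2 * l * (size S)%:R; have d0 : 0 < d by rewrite subr_gt0.
have := le_size (Num.bound ((size S)%:R / d)).+1 isT.
have := archi_boundP (divr_ge0 (ler0n R (size S)) (ltW d0)).
rewrite ltr_pdivrMr // -natr1; move: (Num.bound _)%:R => K.
rewrite /d in d0 *; nra.
Qed.

End CircleTorsion.

Section CircleDimension.
Variables (R : realType) (l : R).
Hypothesis l0 : 0 <= l.

Definition U1_generating (F : set (RmodZ R)) : Prop :=
  (forall x y, F x -> F y -> x <> y -> l < circ_dist x y) /\
  forall x, exists Z : {fset RmodZ R},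
    [set` Z] `<=` F /\ circ_dist x (\sum_(g <- Z) g) <= l.

Lemma is_dimS_U1 (G : {fset RmodZ R}) :
    U1_generating [set` G] ->
    (forall H : {fset RmodZ R},
      U1_generating [set` H] -> (#|` G| <= #|` H|)%N) ->
  is_dimS (U1 l0) #|` G|.
Proof. by move=> lG Gmin; apply/is_dimS_U1P; exact: least_card_fset. Qed.

Lemma U1_generating_ge1 (G : {fset RmodZ R}) : U1_generating [set` G] ->
  1 <= 2 ^+ #|` G|.+1 * l.
Proof.
move=> [_ Ggen]; rewrite exprS mulrAC.
apply: (le_trans (@arcs_cover_ge1 _ l (subset_sums G) l0 _)) => [x|].
  have [Z [ZG xZ]] := Ggen x; exists (\sum_(g <- Z) g) => //.
  by apply/subset_sumsP; exists Z => //; exact/fsubsetP.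
by rewrite ler_wpM2l ?mulr_ge0 // -natrX ler_nat card_subset_sums.
Qed.

Lemma is_dimS_U1_pow2 p : 2 ^- p.+1 <= l -> ((0 < p)%N -> l < 2 ^- p) ->
  is_dimS (U1 l0) p.
Proof.
move=> pl lp; pose G := doublings (torsion_gen R (2 ^ p)) p.
have P0 : (0 < 2 ^ p)%N by rewrite expn_gt0.
have cardG : #|` G| = p by apply: card_doublings; exact: torsion_gen_inj.
rewrite -cardG; apply: is_dimS_U1 => [|H /U1_generating_ge1 Hl].
  split=> [_ _ /doublingsP[i ip ->] /doublingsP[j jp ->] ij|x].
    rewrite (lt_le_trans (lp _)) -?natrX ?circ_dist_torsion_ge //.
      by case: (p) ip.
    rewrite !modn_small ?ltn_exp2l // eqn_exp2l //.
    by apply/eqP => ij'; apply: ij; rewrite ij'.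
  have [c cP xc] := torsion_dense x P0.
  have /subset_sumsP[Z ZG ZE] := mulrn_subset_sums cardG cP.
  exists Z; split; first exact/fsubsetP.
  by rewrite ZE (le_trans xc) // natrX -exprS.
rewrite cardG; have [->//|/lp {}lp] := posnP p.
rewrite -ltnS -(@ltr_eXn2l R 2) ?ltr1n // -[ltLHS]mul1r.
by rewrite -ltr_pdivlMr ?exprn_gt0 // (le_lt_trans Hl) // ltr_pM2l ?exprn_gt0.
Qed.

End CircleDimension.

Section ArakelovDivisor.
Variables (R : realType) (D : arakelov_divisor R).

Lemma lambda_powR : lambda D = 2 `^ deg2 D.
Proof.
by rewrite /powR pnatr_eq0 /= divfK // gt_eqF // ln_gt0 // ltr1n.
Qed.

Lemma lambda_itv :
  2 ^ Num.floor (deg2 D) <= lambda D < 2 ^ (Num.floor (deg2 D) + 1).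
Proof.
have /andP[fd df] := floor_itv (deg2 D).
rewrite lambda_powR -!powR_intmul // ler_powR ?ler1n //=.
by rewrite /powR pnatr_eq0 /= ltr_expR ltr_pM2r // ln_gt0 // ltr1n.
Qed.

Lemma int_itvE x : (x \in int_itv D) =
  (- (Num.truncn (lambda D))%:Z <= x <= (Num.truncn (lambda D))%:Z).
Proof.
rewrite unfold_in -ler_norml -intr_norm -ler_norml -abszE lez_nat.
by rewrite truncn_ge_nat ?lambda_ge0.
Qed.

Lemma is_dimS_H0 :
  is_dimS (H0 D) (if Num.floor (deg2 D) is Posz k then k.+2 else 0%N).
Proof.
have := lambda_itv; case: Num.floor => [k|p].
  rewrite -PoszD addn1 -!exprnP => /andP[kl lk].
  apply: is_dimS_EMsub_int_itv; first exact: int_itvE.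
  by rewrite truncn_ge_nat ?truncn_lt_nat ?lambda_ge0 // !natrX kl.
have -> : Negz p + 1 = - p%:Z by lia.
rewrite -exprnN => /andP[_ lp].
have l1 : lambda D < 1.
  by rewrite (lt_le_trans lp) // invf_le1 ?exprn_gt0 // exprn_ege1 // ler1n.
apply: is_dimS_EMsub_singleton => x.
rewrite int_itvE (_ : Num.truncn _ = 0%N); first lia.
by apply/eqP; rewrite -leqn0 -ltnS truncn_lt_nat ?lambda_ge0.
Qed.

Lemma is_dimS_H1 :
  is_dimS (H1 D) (if Num.floor (deg2 D) is Negz p then p else 0%N).
Proof.
have := lambda_itv; case: Num.floor => [k|p].
  move=> /andP[kl _]; apply: is_dimS_U1_pow2 => //.
  rewrite (le_trans _ kl) // (@le_trans _ _ 1) //.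
    by rewrite invf_le1 // expr1 ler1n.
  by rewrite -exprnP exprn_ege1 // ler1n.
have -> : Negz p + 1 = - p%:Z by lia.
by rewrite NegzE -!exprnN => /andP[pl lp]; exact: is_dimS_U1_pow2.
Qed.

End ArakelovDivisor.

Theorem theorem5p1 (R : realType) (D : arakelov_divisor R) :
  exists n0 n1 : nat,
    [/\ is_dimS (H0 D) n0,
        is_dimS (H1 D) n1
      & n0%:Z - n1%:Z = ceil' (deg2 D) + 1].
Proof.
do 2!eexists; split; [exact: is_dimS_H0|exact: is_dimS_H1|].
by rewrite /ceil' -floor_ge0; case: Num.floor => [k|p] /=; lia.
Qed.
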